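(* Let $k>2$ be an even integer, $\sigma\in S_{k-1}$ a derangement, and let $P_k^\sigma$ be the associated ranked poset (for any choice of the partition $B_1,\dots,B_{k-1}$ used in its construction). Then $P_k^\sigma$ is not the face poset of a triangulation of a manifold.
   Context: Write $[n]=\{1,\dots,n\}$ and $\binom{[k]}{2}$ for the set of 2-element subsets of $[k]$. For an even integer $k>2$ and a derangement (fixed-point-free permutation) $\sigma\in S_{k-1}$, the poset $P_k^\sigma$ is built as follows. Partition $\binom{[k]}{2}$ into $k-1$ blocks $B_1,\dots,B_{k-1}$ so that every $j\in[k]$ lies in exactly one element of each block $B_m$. The elements of $P_k^\sigma$ are $a_i$ ($i\in[k]$), $b_{\{i,j\}}$ ($\{i,j\}\in\binom{[k]}2$), and $c_m$ ($m\in[k-1]$). The $a_i$ are minimal; $b_{\{i,j\}}$ covers exactly $a_i$ and $a_j$; and $c_m$ covers exactly those $b_{\{i,j\}}$ with $\{i,j\}\in B_m\cup B_{\sigma(m)}$. The face poset of a triangulation is the poset of nonempty simplices ordered by inclusion. *)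

(* Defs.v *)
From HB Require Import structures.
From mathcomp Require Import all_boot all_order all_algebra all_fingroup.
From mathcomp Require Import finmap.
Set Implicit Arguments.
Unset Strict Implicit.
Unset Printing Implicit Defensive.
Import Order.TTheory GRing.Theory Num.Theory.

Definition pairs (k : nat) : {set {set 'I_k}} := [set e : {set 'I_k} | #|e| == 2].

Record matching_partition (k : nat) (B : 'I_k.-1 -> {set {set 'I_k}}) : Prop := {
  mp_cover : \bigcup_m B m = pairs k;
  mp_disjoint : forall m m', m != m' -> [disjoint B m & B m'];
  mp_perfect : forall m (j : 'I_k), #|[set e in B m | j \in e]| = 1 }.

Inductive Pelt (k : nat) :=
  | Pa of 'I_k
  | Pb of {e : {set 'I_k} | e \in pairs k}
  | Pc of 'I_k.-1.

Section PeltFinite.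
Variable k : nat.

Definition Pelt_code (x : Pelt k) :
    'I_k + {e : {set 'I_k} | e \in pairs k} + 'I_k.-1 :=
  match x with Pa i => inl (inl i) | Pb e => inl (inr e) | Pc m => inr m end.

Definition Pelt_decode
    (x : 'I_k + {e : {set 'I_k} | e \in pairs k} + 'I_k.-1) : Pelt k :=
  match x with
  | inl (inl i) => Pa i | inl (inr e) => Pb e | inr m => Pc m
  end.

Fact Pelt_codeK : cancel Pelt_code Pelt_decode. Proof. by case. Qed.
HB.instance Definition _ := Finite.copy (Pelt k) (can_type Pelt_codeK).
End PeltFinite.

Definition Pposet (k : nat) (B : 'I_k.-1 -> {set {set 'I_k}})
  (sigma : 'S_k.-1) : Type := Pelt k.

Section Pposet.
Variables (k : nat) (B : 'I_k.-1 -> {set {set 'I_k}}) (sigma : 'S_k.-1).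
Local Notation P := (Pposet B sigma).

(* Pcovered x y : y covers x. *)
Definition Pcovered : rel (Pelt k) := fun x y =>
  match x, y with
  | Pa i, Pb e => i \in val e
  | Pb e, Pc m => (val e \in B m) || (val e \in B (sigma m))
  | _, _ => false
  end.

Definition Ple : rel (Pelt k) := connect Pcovered.

Definition Prank (x : Pelt k) : nat :=
  match x with Pa _ => 0 | Pb _ => 1 | Pc _ => 2 end.

Lemma Pcovered_rank x y : Pcovered x y -> Prank y = (Prank x).+1.
Proof. by case: x y => [?|?|?] [?|?|?]. Qed.

Lemma Ple_rank x y : Ple x y -> x = y \/ Prank x < Prank y.
Proof.
case/connectP=> p; elim: p x => [|z p IHp] x /=; first by left.
case/andP=> /Pcovered_rank xz /IHp{}IHp /IHp; rewrite xz => -[<-|].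
  by right; rewrite xz.
by move=> zy; right; exact: ltnW.
Qed.

Fact Ple_anti : antisymmetric Ple.
Proof.
move=> x y /andP[/Ple_rank[//|xy] /Ple_rank[//|yx]].
by move: (ltn_trans xy yx); rewrite ltnn.
Qed.

HB.instance Definition _ := Finite.on P.
Fact P_display : Order.disp_t. Proof. exact: (Order.Disp tt tt). Qed.
HB.instance Definition _ := Order.Le_isPOrder.Build P_display P
  (connect0 Pcovered) Ple_anti (@connect_trans _ Pcovered).

(* The prescribed covering relation is the covering relation of the order.   *)
Lemma PcoveredP (x y : P) :
  Pcovered x y <->
  (x < y)%O /\ forall z : P, (x < z)%O -> ~~ (z < y)%O.
Proof.
have lt_rank (u v : P) : (u < v)%O -> Prank u < Prank v.
  by move=> uv; case: (Ple_rank (ltW uv)) => // uvE; rewrite uvE ltxx in uv.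
have cov_lt (u v : P) : Pcovered u v -> (u < v)%O.
  move=> uv; rewrite lt_neqAle; apply/andP; split; last exact: connect1.
  by apply/eqP => uvE; move: (Pcovered_rank uv); rewrite uvE => /n_Sn.
split=> [xy|[xy noz]].
  split=> [|z /lt_rank xz]; first exact: cov_lt.
  apply/negP => /lt_rank zy.
  by have := leq_ltn_trans xz zy; rewrite (Pcovered_rank xy) ltnn.
have /connectP[[|z p] /= pth yE] : connect Pcovered x y by exact: ltW xy.
  by rewrite yE ltxx in xy.
have /andP[xz zp] := pth; have zy : (z <= y :> P)%O by apply/connectP; exists p.
have := noz z (cov_lt _ _ xz); rewrite lt_neqAle zy andbT negbK => /eqP <-.
exact: xz.
Qed.
End Pposet.

From mathcomp Require Import all_classical all_reals all_analysis.
Import numFieldNormedType.Exports.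

Local Open Scope classical_set_scope.

Definition order_isomorphic d1 d2 (P : porderType d1) (Q : porderType d2) :=
  exists2 f : P -> Q, bijective f & {mono f : x y / (x <= y)%O}.

Definition homeomorphic (X Y : topologicalType) :=
  exists f : X -> Y, exists g : Y -> X,
    [/\ cancel f g, cancel g f, continuous f & continuous g].

(* Topological manifold (without boundary) of dimension n.  Here the subsets *)
(* U and W carry the subtype topology.                                       *)
Record manifold (R : realType) (n : nat) (M : topologicalType) : Prop := {
  manifold_hausdorff : hausdorff_space M;
  manifold_second_countable : @second_countable M;
  manifold_locally_euclidean : forall p : M,
    exists (U : set M) (W : set 'rV[R]_n),
      [/\ open U, U p, open W & homeomorphic (set_type U) (set_type W)] }.

(* Abstract simplicial complexes; only nonempty simplices are recorded.      *)
Record simplicial_complex (V : choiceType) := SimplicialComplex {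
  simplices :> set {fset V};
  simplices_neq0 : forall s, simplices s -> s != fset0;
  simplices_sub : forall s t : {fset V},
    simplices s -> (t `<=` s)%fset -> t != fset0 -> simplices t }.

Definition face_poset (V : choiceType) (K : simplicial_complex V) : Type :=
  set_type (simplices K).

Section FacePoset.
Variables (V : choiceType) (K : simplicial_complex V).
Local Notation F := (face_poset K).

Definition face_le (s t : F) : bool := (\val s `<=` \val t)%fset.

Fact face_le_refl : reflexive face_le.
Proof. by move=> s; exact: fsubset_refl. Qed.

Fact face_le_anti : antisymmetric face_le.
Proof.
by move=> s t /andP[st ts]; apply: val_inj; apply/eqP; rewrite eqEfsubset; apply/andP.
Qed.

Fact face_le_trans : transitive face_le.
Proof. by move=> t s u; exact: fsubset_trans. Qed.

HB.instance Definition _ := Choice.on F.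
Fact face_display : Order.disp_t. Proof. exact: (Order.Disp tt tt). Qed.
HB.instance Definition _ := Order.isPOrder.Build face_display F
  (fun _ _ => erefl) face_le_refl face_le_anti face_le_trans.
End FacePoset.

Section Realization.
Local Open Scope ring_scope.
Variables (R : realType) (V : choiceType).

(* The closed simplex spanned by s, in barycentric coordinates; since s is   *)
(* finite, the topology of pointwise convergence induces the Euclidean one.  *)
Definition simplex (s : {fset V}) : set {ptws V -> R} :=
  [set x | [/\ forall v, 0 <= x v, forall v, v \notin s -> x v = 0
             & \sum_(v <- s) x v = 1]].

Variable K : simplicial_complex V.

Definition realization : Type :=
  set_type (\bigcup_(s in simplices K) simplex s).
HB.instance Definition _ := Choice.on realization.

Definition simplex_incl s (Ks : simplices K s) (x : set_type (simplex s)) :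
    realization :=
  SigSub (mem_set (bigcup_sup Ks (set_valP x))).

(* Weak (coherent) topology.                                                 *)
Definition realization_open (U : set realization) :=
  forall s (Ks : simplices K s), open (simplex_incl Ks @^-1` U).

Fact realization_openT : realization_open setT.
Proof. by move=> s Ks; rewrite preimage_setT; exact: openT. Qed.

Fact realization_openI : setI_closed realization_open.
Proof.
by move=> A B oA oB s Ks; rewrite preimage_setI; apply: openI; [exact: oA|exact: oB].
Qed.

Fact realization_open_bigU (I : Type) (f : I -> set realization) :
  (forall i, realization_open (f i)) -> realization_open (\bigcup_i f i).
Proof.
by move=> of_ s Ks; rewrite preimage_bigcup; apply: bigcup_open => i _; exact: of_.
Qed.

HB.instance Definition _ := isOpenTopological.Build realization
  realization_openT realization_openI realization_open_bigU.
End Realization.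

Record triangulation (R : realType) (M : topologicalType) := Triangulation {
  tri_vertex : choiceType;
  tri_complex :> simplicial_complex tri_vertex;
  tri_homeo : homeomorphic (realization R tri_complex) M }.

(* Main.v *)
(** A simplex with at least four vertices tops a chain of at least four of its
    faces.  Each [c_m] lies above all [k >= 4] minimal elements [a_i], since
    [B m] is a perfect matching, whereas chains in the poset have at most three
    elements. *)
Require Import Defs.
From HB Require Import structures.
From mathcomp Require Import all_boot all_order all_algebra all_fingroup.
From mathcomp Require Import finmap.
From mathcomp Require Import all_classical all_reals all_analysis.
Set Implicit Arguments.
Unset Strict Implicit.
Unset Printing Implicit Defensive.
Import Order.TTheory.

Section PposetOrder.
Variables (k : nat) (B : 'I_k.-1 -> {set {set 'I_k}}) (sigma : 'S_k.-1).
Local Notation P := (Pposet B sigma).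

Lemma Plt_rank (x y : P) : (x < y)%O -> Prank x < Prank y.
Proof.
by move=> xy; case: (Ple_rank (ltW xy)) => // xyE; rewrite xyE ltxx in xy.
Qed.

Lemma Pa_minimal (i : 'I_k) (x : P) : (x <= (Pa i : P))%O -> x = Pa i.
Proof. by case/Ple_rank. Qed.

(** The matching [B m] has an edge [e] through [i], and [Pb e] then sits between [Pa i] and
    [Pc m]. *)
Lemma Pa_le_Pc (i : 'I_k) (m : 'I_k.-1) :
  matching_partition B -> ((Pa i : P) <= (Pc m : P))%O.
Proof.
move=> Bpart; have /eqP/cards1P[e eE] := mp_perfect Bpart m i.
have : e \in [set e in B m | i \in e]%SET by rewrite eE set11.
rewrite inE => /andP[eB ie].
have pe : e \in pairs k by rewrite -(mp_cover Bpart); apply/bigcupP; exists m.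
apply: (@connect_trans _ _ (Pb (exist _ e pe))); apply: connect1 => //=.
by rewrite eB.
Qed.

End PposetOrder.

Section FacePosetOrder.
Variables (V : choiceType) (K : simplicial_complex V).
Local Notation F := (face_poset K).

Lemma face_of_subset (s : F) (t : {fset V}) :
  (t `<=` val s)%fset -> t != fset0 -> exists t' : F, val t' = t.
Proof.
move=> ts t0; have Kt : simplices K t by apply: simplices_sub ts t0; exact: set_valP.
by exists (SigSub (mem_set Kt)).
Qed.

(** The singleton of any vertex of [s] is a face below [s], so minimality makes it all of [s]. This
    recovers vertices from the order alone. *)
Lemma minimal_face_vertex (s : F) :
  (forall t : F, (t <= s)%O -> t = s) -> exists v, val s = [fset v]%fset.
Proof.
move=> smin; have /fset0Pn[v vs] := simplices_neq0 (set_valP s).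
have vsub : ([fset v] `<=` val s)%fset by rewrite fsub1set.
have [|t tE] := face_of_subset vsub; first by apply/fset0Pn; exists v; rewrite inE.
by exists v; rewrite -tE (smin t) // /Order.le /= /face_le tE.
Qed.

Lemma face_lt (s t : F) (v : V) :
  {subset val s <= val t} -> v \in val t -> v \notin val s -> (s < t)%O.
Proof.
move=> st vt vs; rewrite lt_leAnge; apply/andP; split; first exact/fsubsetP.
by apply/fsubsetPn; exists v.
Qed.

End FacePosetOrder.

Lemma Pposet_not_face_poset (k : nat) (B : 'I_k.-1 -> {set {set 'I_k}})
    (sigma : 'S_k.-1) (V : choiceType) (K : simplicial_complex V) :
  3 < k -> matching_partition B ->
  ~ order_isomorphic (Pposet B sigma) (face_poset K).
Proof.
move=> k_gt3 Bpart [f [g fK gK] fmono].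
have k1_gt0 : 0 < k.-1 by rewrite -ltnS prednK (ltn_trans _ k_gt3).
(* Strict chains of faces will be pulled back along [g], where ranks bound their length. *)
have gmono : {mono g : s t / (s < t)%O}.
  by move=> s t; rewrite -[in RHS](gK s) -[in RHS](gK t) !lt_leAnge !fmono.
pose m : 'I_k.-1 := Ordinal k1_gt0.
pose c : face_poset K := f (Pc m).
(* [f] carries the minimal element [Pa i] to a minimal face, that is, to a single vertex [v i]. *)
have /choice[v vE] : forall i, exists v, val (f (Pa i)) = [fset v]%fset.
  move=> i; apply: minimal_face_vertex => t; rewrite -{1}(gK t) fmono.
  by move/Pa_minimal => <-; rewrite gK.
have v_inj : injective v.
  move=> i j vij; suff [] : Pa i = Pa j by [].
  by apply/(can_inj fK)/val_inj; rewrite !vE vij.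
have vc i : v i \in val c.
  have : (f (Pa i) <= c)%O by rewrite fmono Pa_le_Pc.
  by rewrite /Order.le /= /face_le vE fsub1set.
(* Four distinct indices give four distinct vertices of [c]. The chain runs from the vertex [v i0]
   through an edge [s] and a triangle [t] to [c], each step gaining the next vertex. *)
pose i0 := Ordinal (leq_trans (isT : 0 < 4) k_gt3).
pose i1 := Ordinal (leq_trans (isT : 1 < 4) k_gt3).
pose i2 := Ordinal (leq_trans (isT : 2 < 4) k_gt3).
pose i3 := Ordinal k_gt3.
have [||s sE] := @face_of_subset _ _ c [fset v i0; v i1]%fset.
- by rewrite fsubUset !fsub1set !vc.
- by apply/fset0Pn; exists (v i0); rewrite !inE eqxx.
have [||t tE] := @face_of_subset _ _ c [fset v i0; v i1; v i2]%fset.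
- by rewrite !fsubUset !fsub1set !vc.
- by apply/fset0Pn; exists (v i0); rewrite !inE eqxx.
have as_ : (f (Pa i0) < s)%O.
  apply: (@face_lt _ _ _ _ (v i1)) => [x||]; rewrite ?vE ?sE !inE ?(inj_eq v_inj) //.
  by move=> ->.
have st : (s < t)%O.
  apply: (@face_lt _ _ _ _ (v i2)) => [x||]; rewrite ?sE ?tE !inE ?(inj_eq v_inj) //.
  by move=> ->.
have tc : (t < c)%O.
  apply: (@face_lt _ _ _ _ (v i3)) => [x||]; rewrite ?tE ?inE ?(inj_eq v_inj) //.
  by move=> /orP[/orP[]|] /eqP->.
(* Two strict steps up from [Pa i0], of rank 0, put [g t] at rank at least 2, yet it lies strictly
   below [Pc m], of rank 2. *)
move: as_ st tc; rewrite -!gmono !fK => /Plt_rank as_ /Plt_rank st /Plt_rank tc.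
by have := leq_trans (leq_ltn_trans as_ st) tc.
Qed.

Theorem proposition5p4 (R : realType) (k : nat) (k_gt2 : 2 < k)
    (k_even : ~~ odd k) (sigma : 'S_k.-1)
    (sigma_derangement : forall m, sigma m != m)
    (B : 'I_k.-1 -> {set {set 'I_k}}) (B_partition : matching_partition B) :
  ~ (exists (n : nat) (M : topologicalType) (T : triangulation R M),
       manifold R n M /\ order_isomorphic (Pposet B sigma) (face_poset T)).
Proof.
case=> n [M [T [_]]]; apply: Pposet_not_face_poset B_partition.
(* Evenness rules out [k = 3], which leaves [3 < k]. *)
by rewrite ltn_neqAle k_gt2 andbT; apply: contraNneq k_even => <-.
Qed.
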